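(* Let $n\ge1$ and consider an irreducible birth and death chain $K$ on $\{0,1,\dots,n\}$ with birth, death and holding rates $p_i,q_i,r_i$. Let $\pi$ and $\lambda$ be the stationary distribution and spectral gap of $K$ and set \[ \ell=\max\left\{\max_{j:j<i_0}\sum_{k=j}^{i_0-1}\frac{\pi([0,j])}{\pi(k)p_k},\ \max_{j:j> i_0}\sum_{k=i_0+1}^j\frac{\pi([j,n])}{\pi(k)q_k}\right\}, \] where $i_0\in\{0,\dots,n\}$ is a state such that $\pi([0,i_0])\ge 1/2$ and $\pi([i_0,n])\ge 1/2$. Then \[ \frac{1}{4\ell}\le\lambda\le\frac{2}{\ell}. \]
   Context: A birth and death chain on $\{0,1,\dots,n\}$ with birth rates $p_i$, death rates $q_i$ and holding rates $r_i$ (nonnegative, $p_i+q_i+r_i=1$, $p_n=q_0=0$) is the Markov chain with transition matrix $K(i,i+1)=p_i$, $K(i,i-1)=q_i$, $K(i,i)=r_i$ and all other entries $0$. It is irreducible iff $p_iq_{i+1}>0$ for $0\le i<n$, and then it has a unique stationary distribution $\pi$. Write $\pi(A)=\sum_{i\in A}\pi(i)$, with $[a,b]$ denoting the integers between $a$ and $b$. The spectral gap $\lambda$ of $K$ is the smallest non-zero eigenvalue of $I-K$. The index $j$ ranges over $\{0,\dots,n\}$ and $\max\emptyset:=0$. *)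

(* Defs.v *)
From HB Require Import structures.
From mathcomp Require Import all_boot all_order all_algebra.
From mathcomp Require Import classical_sets reals.

Set Implicit Arguments.
Unset Strict Implicit.
Unset Printing Implicit Defensive.

Import Order.TTheory GRing.Theory Num.Theory.
Local Open Scope ring_scope.

(* The state space {0, 1, ..., n} is 'I_n.+1; probability distributions are
   row vectors, acted on by transition matrices from the right. *)

Record birth_death_rates (R : realType) (n : nat) (p q r : 'I_n.+1 -> R) :
    Prop := BirthDeathRates {
  bd_p_ge0 : forall i, 0 <= p i;
  bd_q_ge0 : forall i, 0 <= q i;
  bd_r_ge0 : forall i, 0 <= r i;
  bd_sum1 : forall i, p i + q i + r i = 1;
  bd_p_max : p ord_max = 0;
  bd_q_0 : q ord0 = 0
}.

Definition bd_matrix (R : realType) (n : nat) (p q r : 'I_n.+1 -> R) :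
    'M[R]_n.+1 :=
  \matrix_(i, j)
    if (j == i.+1 :> nat) then p i
    else if (i == j.+1 :> nat) then q i
    else if i == j then r i
    else 0.

Definition irreducible_chain (R : realType) (n : nat) (K : 'M[R]_n.+1) : Prop :=
  forall i j, exists t : nat, 0 < (K ^+ t) i j.

Definition stationary_distribution (R : realType) (n : nat)
    (K : 'M[R]_n.+1) (pi : 'rV[R]_n.+1) : Prop :=
  [/\ forall i, 0 <= pi 0 i, \sum_i pi 0 i = 1 & pi *m K = pi].

Definition mass (R : realType) (n : nat) (pi : 'rV[R]_n.+1)
    (A : {set 'I_n.+1}) : R := \sum_(i in A) pi 0 i.

Definition state_itv (n a b : nat) : {set 'I_n.+1} :=
  [set i : 'I_n.+1 | (a <= i <= b)%N].

Definition is_spectral_gap (R : realType) (n : nat) (K : 'M[R]_n.+1) (lam : R) :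
    Prop :=
  [/\ eigenvalue (1%:M - K) lam, lam != 0 &
      forall mu, eigenvalue (1%:M - K) mu -> mu != 0 -> lam <= mu].

(* The element satisfying [is_spectral_gap K], which is unique when it exists;
   the default value 0 is never a spectral gap. *)
Definition spectral_gap (R : realType) (n : nat) (K : 'M[R]_n.+1) : R :=
  xget 0 (is_spectral_gap K).

(* The maxima are over nonnegative quantities, and a maximum over the empty set
   is 0, so 0 is the right initial value. *)
Definition bd_ell (R : realType) (n : nat) (p q : 'I_n.+1 -> R)
    (pi : 'rV[R]_n.+1) (i0 : 'I_n.+1) : R :=
  Num.max
    (\big[Num.max/0]_(j < n.+1 | (j < i0)%N)
       \sum_(k < n.+1 | (j <= k < i0)%N)
         mass pi (state_itv n 0 j) / (pi 0 k * p k))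
    (\big[Num.max/0]_(j < n.+1 | (i0 < j)%N)
       \sum_(k < n.+1 | (i0 < k <= j)%N)
         mass pi (state_itv n j n) / (pi 0 k * q k)).

(* Main.v *)
(* Write an eigenvector of [I - K] as [pi * f]; by detailed balance the eigenvalue
   equation says that the flux [w_i (f_i - f_(i+1))], with [w_i = pi_i p_i],
   equals [lam * \sum_(k <= i) pi_k f_k].  Solving this recursion from [f_0 = 1]
   makes every partial sum a polynomial in [lam]; the nonzero eigenvalues are
   roots of the full sum, and a Sturm-type interlacing shows that at its first
   positive root all proper partial sums are positive.  So the gap is that root
   and its eigenfunction is strictly decreasing.
   Lower bound: Muckenhoupt's form of Hardy's inequality on each side of [i0]
   gives [Var f <= \sum pi (f - f i0)^2 <= 4 ell E(f) = 4 ell lam Var f].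
   Upper bound: summing the flux equations from [j] to [i0] and bounding the
   partial sums below by monotonicity of [f] and the median property of [i0]. *)
Require Import Defs.
From HB Require Import structures.
From mathcomp Require Import all_boot all_order all_algebra.
From mathcomp Require Import classical_sets reals.
From mathcomp Require Import ring lra zify.

Set Implicit Arguments.
Unset Strict Implicit.
Unset Printing Implicit Defensive.

Import Order.TTheory GRing.Theory Num.Theory.
Local Open Scope ring_scope.

(** * Cauchy-Schwarz and the weighted Hardy inequality on an initial segment *)

Lemma sum_nat_ge0 (R : numDomainType) (a b : nat) (F : nat -> R) :
  (forall k, (a <= k < b)%N -> 0 <= F k) -> 0 <= \sum_(a <= k < b) F k.
Proof. by move=> F0; rewrite big_nat_cond sumr_ge0 // => k /andP[/F0]. Qed.

(** Cauchy-Schwarz in quotient form, free of square roots. When one term is added, the cross term is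
    absorbed using [D ^+ 2 / C <= T] and a perfect square. *)
Lemma titu_sum_sqr (R : realFieldType) (a b : nat) (d e : nat -> R) :
  (forall k, (a <= k < b)%N -> 0 < e k) ->
  (\sum_(a <= k < b) d k) ^+ 2 <=
  (\sum_(a <= k < b) d k ^+ 2 / e k) * \sum_(a <= k < b) e k.
Proof.
elim: b => [|b IH] e_gt0; first by rewrite !big_geq // expr0n mul0r.
have [ltba|leab] := ltnP b a; first by rewrite !big_geq // expr0n mul0r.
have eb : 0 < e b by apply: e_gt0; rewrite leab ltnSn.
have {IH} : (\sum_(a <= k < b) d k) ^+ 2 <=
    (\sum_(a <= k < b) d k ^+ 2 / e k) * \sum_(a <= k < b) e k.
  by apply: IH => k kab; apply: e_gt0; lia.
rewrite !big_nat_recr //=.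
set D := \sum_(_ <= _ < _) d _; set C := \sum_(_ <= _ < _) e _.
set T := \sum_(_ <= _ < _) _ => IH.
have C0 : 0 <= C.
  by apply: sum_nat_ge0 => k kab; apply/ltW/e_gt0; lia.
have -> : (T + d b ^+ 2 / e b) * (C + e b) =
  T * C + d b ^+ 2 + (T * e b + C * (d b ^+ 2 / e b)).
  by field; rewrite gt_eqF.
suff : 2 * D * d b <= T * e b + C * (d b ^+ 2 / e b) by nra.
have [C00|/negbTE Cn0] := eqVneq C 0.
  have D0 : D = 0 by apply/eqP; rewrite -sqrf_eq0 eq_le sqr_ge0 andbT; nra.
  have T0 : 0 <= T.
    apply: sum_nat_ge0 => k kab; apply: divr_ge0; first exact: sqr_ge0.
    by apply/ltW/e_gt0; lia.
  by rewrite D0 C00 mulr0 !mul0r addr0 mulr_ge0 // ltW.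
have Cp : 0 < C by rewrite lt_def Cn0.
have h : D ^+ 2 / C <= T by rewrite ler_pdivrMr.
apply: (@le_trans _ _ (D ^+ 2 / C * e b + C * (d b ^+ 2 / e b))); last first.
  by rewrite lerD2r ler_wpM2r // ltW.
rewrite -subr_ge0.
have -> : D ^+ 2 / C * e b + C * (d b ^+ 2 / e b) - 2 * D * d b =
  (D * e b - d b * C) ^+ 2 / (C * e b) by field; rewrite !gt_eqF.
by rewrite divr_ge0 ?sqr_ge0 // mulr_ge0 // ltW.
Qed.

(** Factor [x - y] as a difference of squares and bound [sqrt x + sqrt y] by [2 * sqrt x]. At
    [x = 0] the convention [0^-1 = 0] makes both sides vanish. *)
Lemma sqrt_increment (R : rcfType) (x y : R) : 0 <= y -> y <= x ->
  (x - y) / Num.sqrt x <= 2 * (Num.sqrt x - Num.sqrt y).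
Proof.
move=> y0 yx; have x0 : 0 <= x by exact: le_trans yx.
have [x00|xn0] := eqVneq x 0.
  by move: yx; rewrite x00 => yx; rewrite sqrtr0 ler0_sqrtr // invr0 subrr !mulr0.
have sx : 0 < Num.sqrt x by rewrite sqrtr_gt0 lt_def xn0.
rewrite ler_pdivrMr // -{1}(sqr_sqrtr x0) -{1}(sqr_sqrtr y0).
have := ler_wsqrtr yx; have := sqrtr_ge0 y; nra.
Qed.

(* Muckenhoupt's proof: Cauchy-Schwarz with the weights [sqrt (V k)], where
   [V k = \sum_(k <= l < N) 1 / w l]; the two resulting sums telescope up to a
   factor 2 each. *)
Lemma hardy_inequality (R : rcfType) (N : nat) (B : R) (c w f : nat -> R) :
  (forall k, (k < N)%N -> 0 < c k) -> (forall k, (k < N)%N -> 0 < w k) ->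
  (forall j, (j < N)%N ->
     (\sum_(0 <= k < j.+1) c k) * (\sum_(j <= k < N) (w k)^-1) <= B) ->
  \sum_(0 <= m < N) c m * (f m - f N) ^+ 2 <=
  4 * B * \sum_(0 <= k < N) w k * (f k - f k.+1) ^+ 2.
Proof.
move=> c0 w0 hB.
pose V j := \sum_(j <= k < N) (w k)^-1.
pose P j := \sum_(0 <= k < j) c k.
pose u j := Num.sqrt (V j).
pose e k := w k * (f k - f k.+1) ^+ 2.
have V_ge0 j : 0 <= V j.
  by apply: sum_nat_ge0 => k /andP[_ kN]; rewrite invr_ge0 ltW // w0.
have P_ge0 j : (j <= N)%N -> 0 <= P j.
  by move=> jN; apply: sum_nat_ge0 => k /andP[_ kj]; rewrite ltW // c0 //; lia.
have VS j : (j < N)%N -> V j = (w j)^-1 + V j.+1.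
  by move=> jN; rewrite /V big_ltn.
have V_gt0 j : (j < N)%N -> 0 < V j.
  by move=> jN; rewrite VS // ltr_wpDr // invr_gt0 w0.
have PS j : P j.+1 = P j + c j by rewrite /P big_nat_recr.
have P_gt0 j : (j < N)%N -> 0 < P j.+1.
  by move=> jN; rewrite PS ltr_wpDl ?c0 // P_ge0 // ltnW.
have u_gt0 j : (j < N)%N -> 0 < u j by move=> jN; rewrite sqrtr_gt0 V_gt0.
have e_ge0 k : (k < N)%N -> 0 <= e k.
  by move=> kN; rewrite mulr_ge0 ?sqr_ge0 // ltW // w0.
(* Since [(w k)^-1] is the increment of [V] and [u] is its square root, [sqrt_increment] makes the
   sum telescope to [u m], as [V N = 0]. *)
have sumV m : (m <= N)%N -> \sum_(m <= k < N) (w k * u k)^-1 <= 2 * u m.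
  move=> mN.
  have -> : 2 * u m = \sum_(m <= k < N) 2 * (u k - u k.+1).
    rewrite -mulr_sumr; congr (_ * _).
    under eq_bigr do rewrite -opprB.
    rewrite sumrN telescope_sumr // opprB.
    by rewrite [X in _ - X]/u /V big_geq // sqrtr0 subr0.
  apply: ler_sum_nat => k /andP[mk kN].
  have VE : V k - V k.+1 = (w k)^-1 by rewrite VS // addrK.
  have := sqrt_increment (V_ge0 k.+1) (_ : V k.+1 <= V k).
  rewrite VE invfM; apply.
  by rewrite -subr_ge0 VE invr_ge0 ltW // w0.
have sumP m : (m <= N)%N ->
    \sum_(0 <= k < m) c k / Num.sqrt (P k.+1) <= 2 * Num.sqrt (P m).
  move=> mN.
  have -> : 2 * Num.sqrt (P m) =
      \sum_(0 <= k < m) 2 * (Num.sqrt (P k.+1) - Num.sqrt (P k)).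
    rewrite -mulr_sumr telescope_sumr //.
    by rewrite [in X in _ - X]/P big_geq // sqrtr0 subr0.
  apply: ler_sum_nat => k /andP[_ km].
  have kN : (k < N)%N by lia.
  have PE : P k.+1 - P k = c k by rewrite PS addrC addKr.
  have := sqrt_increment (P_ge0 k (ltnW kN)) (_ : P k <= P k.+1).
  by rewrite PE; apply; rewrite -subr_ge0 PE ltW // c0.
have B_ge0 j : (j < N)%N -> 0 <= B.
  by move=> jN; apply: le_trans (hB j jN); exact: mulr_ge0 (P_ge0 _ jN) (V_ge0 j).
have uP j : (j < N)%N -> u j * Num.sqrt (P j.+1) <= Num.sqrt B.
  move=> jN; rewrite -sqrtrM // ler_sqrt ?(B_ge0 j) //.
  by rewrite mulrC hB.
(* Cauchy-Schwarz on the telescoped difference with weights [(w k * u k)^-1], whose sum is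
   controlled by [sumV]. *)
have step1 m : (m < N)%N ->
    (f m - f N) ^+ 2 <= 2 * u m * \sum_(m <= k < N) e k * u k.
  move=> mN.
  have -> : f m - f N = \sum_(m <= k < N) (f k - f k.+1).
    under eq_bigr do rewrite -opprB.
    by rewrite sumrN telescope_sumr ?opprB // ltnW.
  apply: le_trans (titu_sum_sqr _ (e := fun k => (w k * u k)^-1) _) _.
    by move=> k /andP[_ kN]; rewrite invr_gt0 mulr_gt0 ?w0 ?u_gt0.
  rewrite mulrC.
  under [X in _ * X <= _]eq_bigr do rewrite invrK mulrA [_ * w _]mulrC.
  apply: ler_wpM2r; last exact: sumV (ltnW mN).
  apply: sum_nat_ge0 => k /andP[_ kN].
  by rewrite mulr_ge0 ?sqrtr_ge0 // e_ge0.
apply: (@le_trans _ _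
  (\sum_(0 <= m < N) \sum_(m <= k < N) 2 * (c m * u m) * (e k * u k))).
  apply: ler_sum_nat => m /andP[_ mN].
  rewrite -mulr_sumr mulrCA -mulrA mulrCA -mulrA.
  rewrite [in leRHS]mulrCA ler_wpM2l ?(ltW (c0 _ _)) //.
  by rewrite mulrA step1.
(* Exchange the order of summation over the triangle [m <= k]. *)
have -> : \sum_(0 <= m < N) \sum_(m <= k < N) 2 * (c m * u m) * (e k * u k) =
    \sum_(0 <= k < N) 2 * (e k * u k) * \sum_(0 <= m < k.+1) c m * u m.
  under eq_big_nat => m mN.
    rewrite (big_nat_widenl m 0) //; over.
  rewrite (exchange_big_dep_nat xpredT) //=.
  apply: eq_big_nat => k /andP[_ kN].
  rewrite mulr_sumr [RHS](big_nat_widen _ _ N) //=.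
  by apply: eq_bigr => m _; ring.
rewrite mulr_sumr; apply: ler_sum_nat => k /andP[_ kN].
have B0 := B_ge0 k kN.
(* The hypothesis on [B] gives [u m <= sqrt B / sqrt (P m.+1)], after which [sumP] applies. One more
   use of [uP] at [k] turns [sqrt B] into [B]; the constant 4 is the product of the two telescoping
   factors. *)
have h1 : \sum_(0 <= m < k.+1) c m * u m <= Num.sqrt B * (2 * Num.sqrt (P k.+1)).
  apply: le_trans (ler_wpM2l (sqrtr_ge0 B) (sumP k.+1 kN)).
  rewrite mulr_sumr; apply: ler_sum_nat => m /andP[_ mk].
  have mN : (m < N)%N by lia.
  rewrite mulrCA ler_wpM2l ?(ltW (c0 _ _)) // ler_pdivlMr ?uP //.
  by rewrite sqrtr_gt0 P_gt0.
have h2 := uP k kN; have e0 := e_ge0 k kN; have uk := ltW (u_gt0 k kN).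
have sB := sqr_sqrtr B0; have sB0 := sqrtr_ge0 B.
apply: le_trans (ler_wpM2l _ h1) _; first exact: mulr_ge0 _ (mulr_ge0 e0 uk).
rewrite (_ : 2 * _ * _ = 4 * e k * Num.sqrt B * (u k * Num.sqrt (P k.+1))); last ring.
apply: le_trans (ler_wpM2l _ h2) _; first exact: mulr_ge0 (mulr_ge0 _ e0) sB0.
by rewrite -/(e k) -[in leRHS]sB le_eqVlt; apply/orP; left; apply/eqP; ring.
Qed.

(** * Flux equations: reflection, energy, and the two-sided bounds on [lam] *)

(* An eigenvector of [I - K] for [lam], written as [c * f], in flux form: the
   flux through each edge is [lam] times the partial sum to its left. *)
Definition flux_equations (R : realFieldType) (n : nat) (c w f : nat -> R)
    (lam : R) : Prop :=
  (forall i, (i < n)%N ->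
     w i * (f i - f i.+1) = lam * \sum_(0 <= k < i.+1) c k * f k) /\
  \sum_(0 <= k < n.+1) c k * f k = 0.

(** Reflection [k -> n - k], under which edge [k] becomes edge [n - k.+1]. Left partial sums become
    right ones, equal up to sign because the total is zero; the minus sign on [f] keeps decreasing
    solutions decreasing. *)
Lemma flux_equations_rev (R : realFieldType) (n : nat) (c w f : nat -> R)
    (lam : R) :
  flux_equations n c w f lam ->
  flux_equations n (fun k => c (n - k)%N) (fun k => w (n - k.+1)%N)
    (fun k => - f (n - k)%N) lam.
Proof.
case=> flux tot.
have revS i : (i <= n)%N -> \sum_(0 <= k < i.+1) c (n - k)%N * - f (n - k)%N =
    - \sum_(n - i <= k < n.+1) c k * f k.
  move=> ilen; rewrite -sumrN [RHS]big_nat_rev /=.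
  rewrite -{1}(add0n (n - i)%N) big_addn.
  have -> : (n.+1 - (n - i) = i.+1)%N by lia.
  rewrite !big_mkord; apply: eq_bigr => k _; rewrite mulrN.
  by have -> : (n - i + n.+1 - (k + (n - i)).+1 = n - k)%N by have := ltn_ord k; lia.
split=> [i ilt|]; last by rewrite revS // subnn tot oppr0.
rewrite revS; last exact: ltnW.
have := flux (n - i.+1)%N; have -> : ((n - i.+1).+1 = n - i)%N by lia.
rewrite -opprD => flx; move: tot.
rewrite (big_cat_nat (n := (n - i)%N)) //=; last by lia.
move/eqP; rewrite addr_eq0 => /eqP <-; rewrite -flx; last lia.
by rewrite opprB addrC.
Qed.

(** Summation by parts. The induction carries the boundary term at [m], which vanishes at [m = n]
    because the total sum is zero. *)
Lemma flux_energy (R : realFieldType) (n : nat) (c w f : nat -> R) (lam : R) :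
  flux_equations n c w f lam ->
  \sum_(0 <= i < n) w i * (f i - f i.+1) ^+ 2 =
  lam * \sum_(0 <= i < n.+1) c i * f i ^+ 2.
Proof.
case=> flux tot.
suff H m : (m <= n)%N -> \sum_(0 <= i < m) w i * (f i - f i.+1) ^+ 2 +
    lam * (\sum_(0 <= k < m.+1) c k * f k) * f m =
    lam * \sum_(0 <= i < m.+1) c i * f i ^+ 2.
  by have := H n (leqnn n); rewrite tot mulr0 mul0r addr0.
elim: m => [|m IH] mn; first by rewrite !big_nat1 big_geq //; ring.
have {IH} := IH (ltnW mn).
move=> IH; rewrite (big_nat_recr m 0 (fun i => w i * (f i - f i.+1) ^+ 2)) //=.
rewrite (big_nat_recr m.+1 0 (fun k => c k * f k)) //=.
rewrite (big_nat_recr m.+1 0 (fun k => c k * f k ^+ 2)) //= [RHS]mulrDr -IH.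
have -> : w m * (f m - f m.+1) ^+ 2 =
    lam * (\sum_(0 <= k < m.+1) c k * f k) * (f m - f m.+1).
  by rewrite -flux // expr2 mulrA.
ring.
Qed.

Lemma flux_lower (R : rcfType) (n i0 : nat) (c w f : nat -> R) (lam B : R) :
  (i0 <= n)%N ->
  (forall k, (k <= n)%N -> 0 < c k) -> (forall k, (k < n)%N -> 0 < w k) ->
  \sum_(0 <= k < n.+1) c k = 1 ->
  flux_equations n c w f lam ->
  (forall j, (j < i0)%N ->
     (\sum_(0 <= k < j.+1) c k) * (\sum_(j <= k < i0) (w k)^-1) <= B) ->
  (forall j, (i0 < j <= n)%N ->
     (\sum_(j <= k < n.+1) c k) * (\sum_(i0 <= k < j) (w k)^-1) <= B) ->
  \sum_(0 <= k < n.+1) c k * f k ^+ 2 <=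
  4 * B * (lam * \sum_(0 <= k < n.+1) c k * f k ^+ 2).
Proof.
move=> i0n c0 w0 c1 eqs hl hr.
have [_ tot] := eqs.
rewrite -(flux_energy eqs).
have HL : \sum_(0 <= m < i0) c m * (f m - f i0) ^+ 2 <=
    4 * B * \sum_(0 <= k < i0) w k * (f k - f k.+1) ^+ 2.
  by apply: hardy_inequality hl => k ki; [apply: c0|apply: w0]; lia.
(* Hardy's inequality on the reflected segment from [n] down to [i0]. *)
have HR : \sum_(i0.+1 <= m < n.+1) c m * (f m - f i0) ^+ 2 <=
    4 * B * \sum_(i0 <= k < n) w k * (f k - f k.+1) ^+ 2.
  have H := @hardy_inequality R (n - i0) B (fun k => c (n - k)%N)
    (fun k => w (n - k.+1)%N) (fun k => f (n - k)%N).
  rewrite (subKn i0n) in H.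
  rewrite (big_nat_rev _ _ i0.+1) (big_nat_rev _ _ i0) /=.
  rewrite -[in leLHS](add0n i0.+1) big_addn -[in leRHS](add0n i0) big_addn.
  rewrite subSS; apply: le_trans (le_trans (H _ _ _) _).
  - rewrite le_eqVlt; apply/orP; left; apply/eqP.
    apply: eq_big_nat => k kN.
    by have -> : (0 + i0.+1 + n.+1 - (k + i0.+1).+1 = n - k)%N by lia.
  - by move=> k kN; apply: c0; lia.
  - by move=> k kN; apply: w0; lia.
  - move=> j jN; apply: le_trans (hr (n - j)%N _); last lia.
    rewrite le_eqVlt; apply/orP; left; apply/eqP; congr (_ * _).
      rewrite [RHS]big_nat_rev /= -[in RHS](add0n (n - j)%N) big_addn.
      have -> : (n.+1 - (n - j) = j.+1)%N by lia.
      apply: eq_big_nat => k kN; congr c; lia.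
    rewrite [RHS]big_nat_rev /= -[in RHS](add0n i0) big_addn.
    rewrite -[in LHS](add0n j) big_addn.
    have -> : (n - j - i0 = n - i0 - j)%N by lia.
    apply: eq_big_nat => k kN; congr (w _)^-1; lia.
  - rewrite le_eqVlt; apply/orP; left; apply/eqP; congr (_ * _).
    apply: eq_big_nat => k kN.
    have -> : (0 + i0 + n - (k + i0).+1 = n - k.+1)%N by lia.
    have -> : ((n - k.+1).+1 = n - k)%N by lia.
    by rewrite -sqrrN opprB.
have -> : \sum_(0 <= k < n) w k * (f k - f k.+1) ^+ 2 =
    \sum_(0 <= k < i0) w k * (f k - f k.+1) ^+ 2 +
    \sum_(i0 <= k < n) w k * (f k - f k.+1) ^+ 2.
  by rewrite (big_cat_nat (n := i0)).
rewrite mulrDr; apply: le_trans (lerD HL HR).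
have -> : \sum_(0 <= m < i0) c m * (f m - f i0) ^+ 2 +
    \sum_(i0.+1 <= m < n.+1) c m * (f m - f i0) ^+ 2 =
    \sum_(0 <= m < n.+1) c m * (f m - f i0) ^+ 2.
  rewrite [RHS](big_cat_nat (n := i0)) //=; last by lia.
  by rewrite [in RHS](big_ltn (m := i0)) ?ltnS // subrr expr0n mulr0 add0r.
(* Expand the square: mean zero kills the linear term, so centring at [f i0] can only increase the
   sum. *)
have -> : \sum_(0 <= m < n.+1) c m * (f m - f i0) ^+ 2 =
   \sum_(0 <= m < n.+1) c m * f m ^+ 2
   - 2 * f i0 * (\sum_(0 <= m < n.+1) c m * f m)
   + f i0 ^+ 2 * \sum_(0 <= m < n.+1) c m.
  rewrite !mulr_sumr -sumrB -big_split /=; apply: eq_bigr => k _; ring.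
by rewrite tot c1 mulr0 subr0 mulr1 lerDl sqr_ge0.
Qed.

Lemma decreasing_le (R : realFieldType) (n : nat) (f : nat -> R) :
  (forall k, (k < n)%N -> f k.+1 < f k) ->
  forall a b, (a <= b <= n)%N -> f b <= f a.
Proof.
move=> fd a b /andP[ab bn].
elim: b ab bn => [|b IH] ab bn; first by rewrite (_ : a = 0)%N //; lia.
have [->//|ne] := eqVneq a b.+1.
by apply: le_trans (ltW (fd b bn)) (IH _ _); lia.
Qed.

(** Dividing the flux equations by [w k] and summing over [j <= k < i0] expresses [f j - f i0]
    through the partial sums of [c * f]. Each of these is at least half of [P j * (f j - f i0)], and
    the positive factor [f j - f i0] cancels. *)
Lemma flux_upper_left (R : realFieldType) (n i0 j : nat) (c w f : nat -> R)
    (lam : R) :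
  (i0 <= n)%N -> (j < i0)%N -> 0 <= lam ->
  (forall k, (k <= n)%N -> 0 < c k) -> (forall k, (k < n)%N -> 0 < w k) ->
  \sum_(0 <= k < n.+1) c k = 1 ->
  1 / 2 <= \sum_(i0 <= k < n.+1) c k ->
  (forall k, (k < n)%N -> f k.+1 < f k) ->
  flux_equations n c w f lam ->
  lam * ((\sum_(0 <= k < j.+1) c k) * (\sum_(j <= k < i0) (w k)^-1)) <= 2.
Proof.
move=> i0n ji0 lam0 c0 w0 c1 chalf fd [flux tot].
have fle := decreasing_le fd.
have c_ge0 k : (k <= n)%N -> 0 <= c k by move=> kn; rewrite ltW ?c0.
pose g k := f k - f i0.
have g0 k : (k <= i0)%N -> 0 <= g k.
  by move=> ki; rewrite subr_ge0 fle // ki i0n.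
pose P k := \sum_(0 <= l < k.+1) c l.
pose G k := \sum_(0 <= l < k.+1) c l * g l.
have GE m : \sum_(0 <= l < m) c l * g l =
    \sum_(0 <= l < m) c l * f l - f i0 * \sum_(0 <= l < m) c l.
  by rewrite mulr_sumr -sumrB; apply: eq_bigr => l _; rewrite /g; ring.
have half : \sum_(0 <= l < i0) c l <= 1 / 2.
  move: c1; rewrite (big_cat_nat (n := i0)) //=; [by move: chalf; lra|lia].
(* The partial sum is [G k + f i0 * P k]. Mean zero, the median bound and monotonicity give
   [- f i0 <= G k + (1 / 2 - P k) * g k]; together with [P k * g k <= G k] this leaves at least
   [G k / 2], hence at least [P j * g j / 2]. *)
have key k : (j <= k < i0)%N -> P j * g j / 2 <= \sum_(0 <= l < k.+1) c l * f l.
  move=> /andP[jk ki].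
  have P0 : 0 <= P k by apply: sum_nat_ge0 => l lk; apply: c_ge0; lia.
  have -> : \sum_(0 <= l < k.+1) c l * f l = G k + f i0 * P k.
    by rewrite /G GE /P subrK.
  have Gk : P k * g k <= G k.
    rewrite /P mulr_suml; apply: ler_sum_nat => l lk.
    by apply: ler_wpM2l; [apply: c_ge0|rewrite lerD2r; apply: fle]; lia.
  have Gj : P j * g j <= G k.
    apply: (@le_trans _ _ (G j)).
      rewrite /P mulr_suml; apply: ler_sum_nat => l lk.
      by apply: ler_wpM2l; [apply: c_ge0|rewrite lerD2r; apply: fle]; lia.
    rewrite /G [leRHS](big_cat_nat (n := j.+1)) //= lerDl.
    by apply: sum_nat_ge0 => l lk; apply: mulr_ge0; [apply: c_ge0|apply: g0]; lia.
  have Pi0 : P k + \sum_(k.+1 <= l < i0) c l <= 1 / 2.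
    by rewrite -big_cat_nat.
  have tail : \sum_(k.+1 <= l < i0) c l * g l <= (\sum_(k.+1 <= l < i0) c l) * g k.
    rewrite mulr_suml; apply: ler_sum_nat => l lk.
    by apply: ler_wpM2l; [apply: c_ge0|rewrite lerD2r; apply: fle]; lia.
  (* The full sum of [c * g] equals [- f i0], and its terms from [i0] on are nonpositive. *)
  have mean : - f i0 <= G k + \sum_(k.+1 <= l < i0) c l * g l.
    rewrite -big_cat_nat //=.
    have := GE n.+1; rewrite tot c1 mulr1 sub0r => <-.
    rewrite (big_cat_nat (n := i0)) //=; last lia.
    rewrite gerDl -oppr_ge0 -sumrN; apply: sum_nat_ge0 => l lk.
    rewrite -mulrN; apply: mulr_ge0; first by apply: c_ge0; lia.
    by rewrite opprB subr_ge0; apply: fle; lia.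
  have gk := g0 k (ltnW ki).
  have tail0 : 0 <= \sum_(k.+1 <= l < i0) c l.
    by apply: sum_nat_ge0 => l lk; apply: c_ge0; lia.
  have tail2 : (\sum_(k.+1 <= l < i0) c l) * g k <= (1 / 2 - P k) * g k.
    by rewrite ler_wpM2r // lerBrDl.
  have m1 : - f i0 * P k <= (G k + (1 / 2 - P k) * g k) * P k.
    by rewrite ler_wpM2r // (le_trans mean) // lerD2l (le_trans tail).
  have m2 : (1 / 2 - P k) * (P k * g k) <= (1 / 2 - P k) * G k.
    by rewrite ler_wpM2l //; lra.
  by lra.
have gj : 0 < g j.
  rewrite subr_gt0; apply: le_lt_trans (fd j _); last lia.
  by apply: fle; lia.
rewrite -/(P j) -(ler_pM2r gj) mulrC.
have -> : 2 * g j = \sum_(j <= k < i0) 2 * (f k - f k.+1).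
  rewrite -mulr_sumr; congr (_ * _); under eq_bigr do rewrite -opprB.
  by rewrite sumrN telescope_sumr ?opprB // ltnW.
rewrite !mulr_sumr; apply: ler_sum_nat => k kj.
have wk : 0 < w k by apply: w0; lia.
have -> : f k - f k.+1 = (w k)^-1 * (lam * \sum_(0 <= l < k.+1) c l * f l).
  by rewrite -flux ?mulKf ?gt_eqF //; lia.
have -> : g j * (lam * (P j * (w k)^-1)) =
   2 * ((w k)^-1 * (lam * (P j * g j / 2))) by field; rewrite gt_eqF.
by rewrite !ler_wpM2l ?invr_ge0 ?key // ltW.
Qed.

Lemma flux_upper_right (R : realFieldType) (n i0 j : nat) (c w f : nat -> R)
    (lam : R) :
  (i0 < j <= n)%N -> 0 <= lam ->
  (forall k, (k <= n)%N -> 0 < c k) -> (forall k, (k < n)%N -> 0 < w k) ->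
  \sum_(0 <= k < n.+1) c k = 1 ->
  1 / 2 <= \sum_(0 <= k < i0.+1) c k ->
  (forall k, (k < n)%N -> f k.+1 < f k) ->
  flux_equations n c w f lam ->
  lam * ((\sum_(j <= k < n.+1) c k) * (\sum_(i0 <= k < j) (w k)^-1)) <= 2.
Proof.
move=> /andP[ij jn] lam0 c0 w0 c1 chalf fd /flux_equations_rev eqs.
have revc m : (m <= n)%N ->
    \sum_(0 <= k < (n - m).+1) c (n - k)%N = \sum_(m <= k < n.+1) c k.
  move=> mn; rewrite [RHS]big_nat_rev /= -[in RHS](add0n m) big_addn -subSn //.
  by apply: eq_big_nat => k kn; congr c; lia.
have := flux_upper_left (i0 := (n - i0)%N) (j := (n - j)%N) _ _ _ _ _ _ _ _ eqs.
rewrite revc //; set s := \sum_(_ <= _ < _) (w (_ - _)%N)^-1.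
have -> : s = \sum_(i0 <= k < j) (w k)^-1.
  rewrite /s big_nat_rev /= -(add0n (n - j)%N) big_addn.
  rewrite -[in RHS](add0n i0) big_addn.
  have -> : (n - i0 - (n - j) = j - i0)%N by lia.
  by apply: eq_big_nat => k kn; congr (w _)^-1; lia.
apply=> //; try lia.
- by move=> k kn; apply: c0; lia.
- by move=> k kn; apply: w0; lia.
- by rewrite -c1 -revc // subn0.
- suff -> : \sum_(n - i0 <= k < n.+1) c (n - k)%N = \sum_(0 <= k < i0.+1) c k by [].
  rewrite [LHS]big_nat_rev /= -[in LHS](add0n (n - i0)%N) big_addn.
  have -> : (n.+1 - (n - i0) = i0.+1)%N by lia.
  by apply: eq_big_nat => k kn; congr c; lia.
- move=> k kn; rewrite ltrN2.
  by have -> : (n - k = (n - k.+1).+1)%N by [lia]; apply: fd; lia.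
Qed.

(** * First roots of polynomials and the shooting solution *)

(** Induction on the size. Take a root [c] in the interval; if [p] is nonpositive somewhere before
    [c], divide by [c - x], which is positive there, and recurse on the quotient. *)
Lemma poly_first_root (R : rcfType) (p : {poly R}) (a : R) :
  0 <= a -> 0 < p.[0] -> p.[a] <= 0 ->
  exists b, [/\ 0 < b <= a, p.[b] = 0 & forall x, 0 <= x < b -> 0 < p.[x]].
Proof.
have [m] := ubnP (size p); elim: m => // m IH in p a *.
rewrite ltnS => sz a0 p0 pa.
have [c /andP[c0 ca] rc] : exists2 c, 0 <= c <= a & root (- p) c.
  by apply: poly_ivt => //; rewrite !hornerN oppr_le0 oppr_ge0 ltW.
have {}rc : root p c by rewrite rootN in rc.
have c_gt0 : 0 < c.
  rewrite lt_def c0 andbT; apply: contraTneq p0 => c00.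
  by move: rc; rewrite c00 /root => /eqP ->; rewrite ltxx.
have [q pE] := factor_theorem _ _ rc.
have pEx x : p.[x] = (- q).[x] * (c - x).
  by rewrite pE hornerM hornerXsubC hornerN; ring.
have [[x xc px]|nox] := boolp.EM (exists2 x, 0 <= x < c & p.[x] <= 0); last first.
  exists c; rewrite c_gt0 ca; split=> //; first exact/eqP.
  by move=> x xc; rewrite ltNge; apply/negP => px; apply: nox; exists x.
case/andP: xc => x0 xc.
have q0 : q != 0.
  by apply: contraTneq p0 => q00; rewrite pE q00 mul0r horner0 ltxx.
have szq : (size (- q) < m)%N.
  by rewrite size_polyN; move: sz; rewrite pE size_Mmonic ?monicXsubC ?size_XsubC // addn2.
have [||b [/andP[b0 bx] qb qpos]] := IH _ _ szq x0.
- by move: p0; rewrite pEx subr0 pmulr_lgt0.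
- by move: px; rewrite pEx pmulr_lle0 // subr_gt0.
exists b; rewrite b0 (le_trans bx) ?(le_trans (ltW xc)) //; split=> //.
  by rewrite pEx qb mul0r.
move=> y /andP[y0 yb]; rewrite pEx mulr_gt0 ?qpos ?y0 // subr_gt0.
exact: lt_trans yb (le_lt_trans bx xc).
Qed.

(* [shoot c w i] is the pair [(f_i, \sum_(k <= i) c k * f_k)], as polynomials in
   [lam], where [f] solves the flux equations with [f_0 = 1]. *)
Fixpoint shoot (R : fieldType) (c w : nat -> R) (i : nat) :
    {poly R} * {poly R} :=
  if i is j.+1 then
    let f := (shoot c w j).1 - (w j)^-1 *: ('X * (shoot c w j).2) in
    (f, (shoot c w j).2 + c j.+1 *: f)
  else (1, (c 0%N)%:P).

Section Shooting.
Variables (R : rcfType) (n : nat) (c w : nat -> R).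
Hypothesis c0 : forall k, (k <= n)%N -> 0 < c k.
Hypothesis w0 : forall k, (k < n)%N -> 0 < w k.

Let f i x := (shoot c w i).1.[x].
Let S i x := (shoot c w i).2.[x].

Let f_succ i x : f i.+1 x = f i x - (w i)^-1 * (x * S i x).
Proof. by rewrite /f /= hornerD hornerN hornerZ [('X * _)]mulrC hornerMX [x * _]mulrC. Qed.

Let S_succ i x : S i.+1 x = S i x + c i.+1 * f i.+1 x.
Proof. by rewrite /S /= hornerD hornerZ. Qed.

Lemma shoot_sum i x : S i x = \sum_(0 <= k < i.+1) c k * f k x.
Proof.
elim: i => [|i IH]; first by rewrite big_nat1 /S /f /= !hornerE.
by rewrite big_nat_recr // -IH S_succ.
Qed.

Lemma shoot_flux i x : (i < n)%N -> w i * (f i x - f i.+1 x) = x * S i x.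
Proof. by move=> i_n; rewrite f_succ opprB addrC subrK mulVKf // gt_eqF ?w0. Qed.

Lemma shoot_at0 i : f i 0 = 1.
Proof.
elim: i => [|i IH]; first by rewrite /f hornerE.
by rewrite f_succ IH mul0r mulr0 subr0.
Qed.

Lemma shoot_sum_at0_gt0 i : (i <= n)%N -> 0 < S i 0.
Proof.
elim: i => [|i IH] i_n; first by rewrite /S /= hornerC c0.
by rewrite S_succ shoot_at0 mulr1 addr_gt0 ?c0 // IH // ltnW.
Qed.

(* Sturm-type interlacing: at the first root [a] of [S i] one has [f i < 0], so
   [S i.+1] is negative at [a] and has its first root before [a]. *)
Lemma shoot_first_root i : (0 < i <= n)%N ->
  exists a, [/\ 0 < a, S i a = 0,
    forall k x, (k < i)%N -> 0 <= x <= a -> 0 < S k x &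
    forall x, 0 <= x < a -> 0 < S i x].
Proof.
elim: i => // i IH /andP[_ i_n].
have [i0|i_gt0] := posnP i.
  subst i; have S0 x : S 0 x = c 0%N by rewrite /S hornerC.
  have f0 x : f 0 x = 1 by rewrite /f hornerE.
  have c00 := c0 (leq0n n); have c10 := c0 i_n; have w00 := w0 i_n.
  (* The root of [S 1], which is affine in [x]. *)
  pose a := w 0%N * (c 0%N + c 1%N) / (c 0%N * c 1%N).
  have a_ge0 : 0 <= a by rewrite divr_ge0 // !mulr_ge0 // ?addr_ge0 // ltW.
  have Sa : S 1 a = 0.
    by rewrite S_succ f_succ S0 f0 /a; field; rewrite !gt_eqF.
  have [b [/andP[b0 _] Sb Spos]] := poly_first_root a_ge0 (shoot_sum_at0_gt0 i_n)
    (eq_ind_r (fun z => z <= 0) (lexx 0) Sa).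
  by exists b; split=> // k x; rewrite ltnS leqn0 => /eqP -> _; rewrite S0.
have [|a [a0 Sia Sk Si]] := IH; first by rewrite i_gt0 ltnW.
case: i => // i in IH i_n i_gt0 Sia Sk Si *.
have a_ge0 := ltW a0.
have fa : f i.+1 a < 0.
  have : 0 < S i a by rewrite Sk // a_ge0 lexx.
  move: Sia; rewrite S_succ => /eqP; rewrite addr_eq0 => /eqP ->.
  by rewrite oppr_gt0 pmulr_rlt0 // c0 // ltnW.
(* At [a] the sum [S i.+1] vanishes, so no flux crosses the next edge and
   [f i.+2 a = f i.+1 a < 0]. *)
have Sa : S i.+2 a < 0.
  rewrite S_succ f_succ Sia mulr0 mulr0 subr0 add0r.
  by rewrite pmulr_rlt0 // c0.
have [b [/andP[b0 ba] Sb Spos]] :=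
  poly_first_root a_ge0 (shoot_sum_at0_gt0 i_n) (ltW Sa).
(* Strictness makes [S i.+1] positive on the closed interval up to [b]. *)
have {}ba : b < a.
  by rewrite lt_neqAle ba andbT; apply: contraTneq Sa => <-; rewrite /S Sb ltxx.
exists b; split=> // k x; rewrite ltnS leq_eqVlt => /orP[/eqP->|ki] /andP[x0 xb].
  by rewrite Si // x0 (le_lt_trans xb).
by rewrite Sk // x0 (le_trans xb) // ltW.
Qed.

Lemma shoot_unique (g : nat -> R) (lam : R) :
  flux_equations n c w g lam ->
  forall i, (i <= n)%N -> g i = g 0%N * f i lam.
Proof.
case=> flux _ i i_n.
suff [] : g i = g 0%N * f i lam /\
    \sum_(0 <= k < i.+1) c k * g k = g 0%N * S i lam by [].
elim: i i_n => [|i IH] i_n.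
  by rewrite big_nat1 /f /S /= !hornerE mulrC.
have [gi Si] := IH (ltnW i_n).
have gS : g i.+1 = g 0%N * f i.+1 lam.
  rewrite f_succ mulrBr -gi.
  have -> : g 0%N * ((w i)^-1 * (lam * S i lam)) = (w i)^-1 * (lam * (g 0%N * S i lam)) by ring.
  by rewrite -Si -flux // mulKf ?opprB ?subrKC // gt_eqF // w0.
by split=> //; rewrite big_nat_recr //= Si gS S_succ; ring.
Qed.

(** Take [a] to be the first positive root of [S n]. The proper partial sums are positive at [a], so
    every flux is positive and [h] decreases. Any other solution is a multiple of the shooting
    solution, so its [lam] is a root of [S n] and cannot precede [a]. *)
Lemma flux_equations_first : (0 < n)%N ->
  exists a (h : nat -> R),
  [/\ 0 < a, flux_equations n c w h a, 0 < h 0%N,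
      forall k, (k < n)%N -> h k.+1 < h k &
      forall g lam, flux_equations n c w g lam -> 0 < lam ->
        (exists2 k, (k <= n)%N & g k != 0) -> a <= lam].
Proof.
move=> n_gt0; have [|a [a0 Sa Sk Sn]] := @shoot_first_root n.
  by rewrite n_gt0 leqnn.
exists a, (f^~ a); split=> //.
- by split=> [i i_n|]; rewrite -shoot_sum // shoot_flux.
- by rewrite /f hornerE.
- move=> k kn; rewrite -subr_gt0 -(pmulr_rgt0 _ (w0 kn)) shoot_flux //.
  by rewrite mulr_gt0 // Sk // ltW //=.
move=> g lam eqs lam0 [k kn gk].
have gE := shoot_unique eqs.
have g00 : g 0%N != 0 by apply: contraNneq gk => g00; rewrite gE // g00 mul0r.
rewrite leNgt; apply/negP => lama; have := Sn lam.
rewrite ltW //= lama => /(_ isT).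
suff -> : S n lam = 0 by rewrite ltxx.
apply: (mulfI g00); rewrite mulr0 -eqs.2 shoot_sum mulr_sumr.
by apply: eq_big_nat => i i_n; rewrite (gE i); [ring|lia].
Qed.

End Shooting.

(** * Birth and death chains: eigenvectors as solutions of the flux equations *)

(** Indexing by naturals allows shifts and reflections without casts; the value 0 beyond [n] makes
    the edge leaving [n] carry no flux. *)
Definition nat_ext (R : nmodType) (n : nat) (x : 'I_n.+1 -> R) (k : nat) : R :=
  if (k <= n)%N then x (inord k) else 0.

Lemma nat_ext_ord (R : nmodType) (n : nat) (x : 'I_n.+1 -> R) (i : 'I_n.+1) :
  nat_ext x i = x i.
Proof. by rewrite /nat_ext -ltnS ltn_ord inord_val. Qed.

Lemma nat_ext_out (R : nmodType) (n : nat) (x : 'I_n.+1 -> R) (k : nat) :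
  (n < k)%N -> nat_ext x k = 0.
Proof. by rewrite /nat_ext ltnNge => /negbTE ->. Qed.

Lemma sum_nat_ext (R : nmodType) (n : nat) (x : 'I_n.+1 -> R) (a : nat) :
  \sum_(k < n.+1 | k == a :> nat) x k = nat_ext x a.
Proof.
rewrite /nat_ext; case: leqP => [an|na].
  rewrite (big_pred1 (inord a)) // => k.
  by rewrite /= -(inj_eq val_inj) /= inordK.
by rewrite big_pred0 // => k; apply/negbTE; have := ltn_ord k; lia.
Qed.

Lemma big_nat_ext (R : nmodType) (n : nat) (x : 'I_n.+1 -> R) (P : pred nat) :
  \sum_(0 <= k < n.+1 | P k) nat_ext x k = \sum_(k < n.+1 | P k) x k.
Proof. by rewrite big_mkord; apply: eq_bigr => k _; rewrite nat_ext_ord. Qed.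

Section Chain.
Variables (R : realType) (n : nat) (p q r : 'I_n.+1 -> R).
Hypothesis rates : birth_death_rates p q r.
Let K := bd_matrix p q r.

(** The net flow of [v] through the edge from [i] to [i.+1]. *)
Definition cut_flux (v : 'rV[R]_n.+1) (i : nat) : R :=
  nat_ext (v 0) i * nat_ext p i - nat_ext (v 0) i.+1 * nat_ext q i.+1.

(** [I - K] acts as a discrete divergence: writing [v 0 j] as [v 0 j * (p j + q j + r j)] cancels
    the holding term and groups the rest by edges. *)
Lemma bd_mulmx_flux (v : 'rV[R]_n.+1) (j : 'I_n.+1) :
  (v *m (1%:M - K)) 0 j =
  cut_flux v j - (if j : nat is i.+1 then cut_flux v i else 0).
Proof.
rewrite mulmxBr mulmx1 !mxE.
have -> : \sum_k v 0 k * K k j =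
    (if j : nat is i.+1 then nat_ext (v 0) i * nat_ext p i else 0) +
    nat_ext (v 0) j.+1 * nat_ext q j.+1 + v 0 j * r j.
  have KE k : v 0 k * K k j = (if j == k.+1 :> nat then v 0 k * p k else 0) +
      (if k == j.+1 :> nat then v 0 k * q k else 0) +
      (if k == j then v 0 k * r k else 0).
    rewrite mxE; case: ifP => [/eqP jk|_].
      rewrite ifF; last by apply/eqP; lia.
      by rewrite ifF ?addr0 //; apply/eqP => kj; move: jk; rewrite kj; lia.
    case: ifP => [/eqP kj|_]; last by rewrite !add0r; case: ifP; rewrite ?mulr0.
    by rewrite ifF ?addr0 ?add0r //; apply/eqP => kj'; move: kj; rewrite kj'; lia.
  have extM (x y : 'I_n.+1 -> R) i :
      nat_ext x i * nat_ext y i = nat_ext (fun k => x k * y k) i.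
    by rewrite /nat_ext; case: ifP; rewrite ?mulr0.
  under eq_bigr do rewrite KE.
  rewrite !big_split /= -!big_mkcond /= big_pred1_eq; congr (_ + _ + _).
    case: (nat_of_ord j) => [|i]; first by rewrite big_pred0.
    rewrite extM -sum_nat_ext; apply: eq_bigl => k.
    by rewrite eqSS eq_sym.
  by rewrite sum_nat_ext extM.
rewrite /cut_flux nat_ext_ord nat_ext_ord.
have := bd_sum1 rates j.
case: (nat_of_ord j) (nat_ext_ord (v 0) j) (nat_ext_ord q j) => [|i] vj qj s1.
  have q00 : q j = 0.
    by rewrite -qj /nat_ext /= -[inord 0]/(inord (ord0 : 'I_n.+1)) inord_val (bd_q_0 rates).
  rewrite -{1}[v 0 j]mulr1 -s1 q00; ring.
rewrite vj qj -{1}[v 0 j]mulr1 -s1; ring.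
Qed.

Lemma sum_bd_mulmx (v : 'rV[R]_n.+1) (i : nat) : (i <= n)%N ->
  \sum_(0 <= k < i.+1) nat_ext ((v *m (1%:M - K)) 0) k = cut_flux v i.
Proof.
have E k : (k <= n)%N -> nat_ext ((v *m (1%:M - K)) 0) k =
    cut_flux v k - (if k is l.+1 then cut_flux v l else 0).
  move=> kn; have := bd_mulmx_flux v (Ordinal (kn : (k < n.+1)%N)).
  by rewrite -(nat_ext_ord (_ 0)).
elim: i => [|i IH] i_n; first by rewrite big_nat1 E // subr0.
by rewrite big_nat_recr //= IH 1?ltnW // E // subrKC.
Qed.

Lemma cut_flux_max (v : 'rV[R]_n.+1) : cut_flux v n = 0.
Proof.
rewrite /cut_flux (nat_ext_out q) // mulr0 subr0.
by rewrite -[X in nat_ext p X]/(nat_of_ord (@ord_max n)) nat_ext_ord (bd_p_max rates) mulr0.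
Qed.

Lemma bd_matrix_ge0 i j : 0 <= K i j.
Proof.
rewrite mxE; do 3?[case: ifP => _ //]; 
  [exact: bd_p_ge0 rates _|exact: bd_q_ge0 rates _|exact: bd_r_ge0 rates _].
Qed.

Hypothesis irr : irreducible_chain K.

(** If [p i = 0], no power of [K] leads from [[0, i]] to a state above [i], contradicting
    irreducibility. *)
Lemma birth_gt0 (i : 'I_n.+1) : (i < n)%N -> 0 < p i.
Proof.
move=> i_n; rewrite lt_def (bd_p_ge0 rates) andbT; apply/eqP => pi0.
have H t (a b : 'I_n.+1) : (a <= i < b)%N -> (K ^+ t) a b = 0.
  elim: t a => [|t IH] a /andP[ai ib].
    by rewrite expr0 mxE; case: eqP => // ab; move: ai ib; rewrite ab; lia.
  rewrite exprS mxE big1 // => k _; have [ki|ik] := leqP k i.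
    by rewrite IH ?mulr0 // ki ib.
  suff -> : K a k = 0 by rewrite mul0r.
  rewrite mxE; case: eqP => [ka|_].
    by rewrite -pi0; congr p; apply: val_inj => /=; lia.
  case: eqP => [|_]; first lia.
  by case: eqP => // ak; move: ai ik; rewrite ak; lia.
have [t] := irr i ord_max; rewrite H ?ltxx //.
by rewrite leqnn.
Qed.

Variable pi : 'rV[R]_n.+1.
Hypothesis stat : stationary_distribution K pi.

(** Some state [j] has positive mass, and a power of [K], which also fixes [pi], carries part of it
    to [i]. *)
Lemma stationary_gt0 i : 0 < pi 0 i.
Proof.
have [pi0 pi1 piK] := stat.
have [j pj] : exists j, 0 < pi 0 j.
  have [|j] := @psumr_neq0P _ _ xpredT (pi 0) (fun i _ => pi0 i).
    by rewrite pi1; apply/eqP/oner_neq0.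
  by move=> /andP[_ ?]; exists j.
have [t Kt] := irr j i.
have Kt_ge0 s a b : 0 <= (K ^+ s) a b.
  elim: s a b => [|s IH] a b; first by rewrite expr0 mxE ler0n.
  by rewrite exprS mxE sumr_ge0 // => k _; rewrite mulr_ge0 ?bd_matrix_ge0.
have piKt s : pi *m K ^+ s = pi.
  by elim: s => [|s IH]; rewrite ?expr0 ?mulmx1 // exprSr mulmxA IH.
rewrite -(piKt t) mxE (bigD1 j) //= ltr_pwDl ?mulr_gt0 //.
by rewrite sumr_ge0 // => k _; rewrite mulr_ge0.
Qed.

Let c k := nat_ext (pi 0) k.
Let w k := c k * nat_ext p k.

(** Stationarity makes the divergence of [pi] zero, so summing from the left end shows that every
    cut flux vanishes. *)
Lemma detailed_balance i : (i <= n)%N -> w i = c i.+1 * nat_ext q i.+1.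
Proof.
move=> i_n; apply/eqP; rewrite -subr_eq0; apply/eqP.
have [_ _ piK] := stat.
have := sum_bd_mulmx pi i_n; rewrite mulmxBr mulmx1 piK subrr => E.
rewrite -[LHS]/(cut_flux pi i) -E big1 // => k _.
by rewrite /nat_ext mxE if_same.
Qed.

Lemma stationary_ext_gt0 k : (k <= n)%N -> 0 < c k.
Proof. by move=> kn; rewrite /c /nat_ext kn stationary_gt0. Qed.

Lemma conductance_gt0 k : (k < n)%N -> 0 < w k.
Proof.
move=> kn; rewrite mulr_gt0 ?stationary_ext_gt0 1?ltnW //.
by rewrite /nat_ext ltnW // birth_gt0 // inordK // ltnS ltnW.
Qed.

Lemma cut_flux_density (v : 'rV[R]_n.+1) (f : nat -> R) :
  (forall k, (k <= n)%N -> nat_ext (v 0) k = c k * f k) ->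
  forall i, (i <= n)%N -> cut_flux v i = w i * (f i - f i.+1).
Proof.
move=> vE i i_n; rewrite mulrBr {2}detailed_balance // /cut_flux vE //.
have -> : nat_ext (v 0) i.+1 = c i.+1 * f i.+1.
  have [/vE //|ni] := leqP i.+1 n.
  by rewrite /c !nat_ext_out ?mul0r.
by rewrite /w; ring.
Qed.

(** Sum the eigenvalue equation over [[0, i]]. At [i = n] the cut flux is zero, and [lam != 0] then
    forces the total sum to vanish. *)
Lemma eigenvector_flux (v : 'rV[R]_n.+1) (lam : R) : lam != 0 ->
  v *m (1%:M - K) = lam *: v ->
  flux_equations n c w (fun k => nat_ext (v 0) k / c k) lam.
Proof.
move=> lam0 ev; set f := fun k => _.
have vE k : (k <= n)%N -> nat_ext (v 0) k = c k * f k.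
  by move=> kn; rewrite /f mulrC divfK // gt_eqF ?stationary_ext_gt0.
have E i : (i <= n)%N ->
    cut_flux v i = lam * \sum_(0 <= k < i.+1) c k * f k.
  move=> i_n; rewrite -sum_bd_mulmx // ev mulr_sumr; apply: eq_big_nat => k ki.
  by rewrite -vE; [rewrite /nat_ext; case: ifP; rewrite ?mulr0 ?mxE|lia].
split=> [i i_n|]; first by rewrite -(cut_flux_density vE) ?E // ltnW.
by apply: (mulfI lam0); rewrite -E // cut_flux_max mulr0.
Qed.

Lemma flux_eigenvector (h : nat -> R) (lam : R) :
  flux_equations n c w h lam ->
  (\row_i (c i * h i)) *m (1%:M - K) = lam *: \row_i (c i * h i).
Proof.
case=> flux tot; set v := \row_i _.
have vE k : (k <= n)%N -> nat_ext (v 0) k = c k * h k.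
  by move=> kn; rewrite /nat_ext kn mxE inordK.
have E i : (i <= n)%N ->
    cut_flux v i = lam * \sum_(0 <= k < i.+1) c k * h k.
  rewrite leq_eqVlt => /orP[/eqP ->|i_n]; first by rewrite cut_flux_max tot mulr0.
  by rewrite (cut_flux_density vE) ?flux // ltnW.
apply/rowP => j; rewrite bd_mulmx_flux !mxE.
have := ltn_ord j; rewrite ltnS; case: (nat_of_ord j) => [|i] jn.
  by rewrite E // big_nat1 subr0.
by rewrite !E // 1?ltnW // (big_nat_recr i.+1) //= mulrDr addrAC subrr add0r.
Qed.

(** By [flux_energy], [lam] times a positive norm equals a nonnegative energy. *)
Lemma eigenvalue_gt0 (v : 'rV[R]_n.+1) (lam : R) : lam != 0 -> v != 0 ->
  v *m (1%:M - K) = lam *: v -> 0 < lam.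
Proof.
move=> lam0 v0 /(eigenvector_flux lam0) eqs.
pose f k := nat_ext (v 0) k / c k.
have en : \sum_(0 <= i < n) w i * (f i - f i.+1) ^+ 2 =
    lam * \sum_(0 <= i < n.+1) c i * f i ^+ 2 := flux_energy eqs.
rewrite lt_def lam0 /= leNgt; apply/negP => lam_lt0.
have sum_ge0 : 0 <= \sum_(0 <= i < n) w i * (f i - f i.+1) ^+ 2.
  by apply: sum_nat_ge0 => k kn; rewrite mulr_ge0 ?sqr_ge0 // ltW // conductance_gt0.
have [i vi] : exists i : 'I_n.+1, v 0 i != 0.
  by apply/existsP; rewrite -negb_forall; apply: contraNN v0 => /forallP v0;
    apply/eqP/rowP => i; rewrite mxE; apply/eqP.
have norm_gt0 : 0 < \sum_(0 <= i < n.+1) c i * f i ^+ 2.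
  rewrite big_mkord (bigD1 i) //= ltr_pwDl //.
    rewrite mulr_gt0 //; first by rewrite stationary_ext_gt0 // -ltnS.
    by rewrite lt_def sqr_ge0 sqrf_eq0 /f mulf_neq0 ?nat_ext_ord // invr_eq0 gt_eqF //
      stationary_ext_gt0 // -ltnS.
  rewrite sumr_ge0 // => k _; rewrite mulr_ge0 ?sqr_ge0 // ltW //.
  by rewrite stationary_ext_gt0 // -ltnS.
by move: sum_ge0; rewrite en pmulr_lge0 // leNgt lam_lt0.
Qed.

Lemma mass_state_itv (a b : nat) : (b <= n)%N ->
  mass pi (state_itv n a b) = \sum_(a <= k < b.+1) c k.
Proof.
move=> bn; rewrite /mass; under eq_bigl do rewrite inE.
rewrite -(big_nat_ext (pi 0) (fun k => (a <= k <= b)%N)).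
by rewrite (big_nat_widenl a 0) // (big_nat_widen _ _ n.+1).
Qed.

End Chain.

(** * Identification of the gap and the two estimates *)

Theorem theorem1p2 (R : realType) (n : nat) (n_ge1 : (1 <= n)%N)
    (p q r : 'I_n.+1 -> R) (rates : birth_death_rates p q r)
    (irr : irreducible_chain (bd_matrix p q r))
    (pi : 'rV[R]_n.+1)
    (stat : stationary_distribution (bd_matrix p q r) pi)
    (i0 : 'I_n.+1)
    (i0_left : 1 / 2 <= mass pi (state_itv n 0 i0))
    (i0_right : 1 / 2 <= mass pi (state_itv n i0 n)) :
  let lam := spectral_gap (bd_matrix p q r) in
  let ell := bd_ell p q pi i0 in
  1 / (4 * ell) <= lam /\ lam <= 2 / ell.
Proof.
move=> lam ell.
pose c k := nat_ext (pi 0) k.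
pose w k := c k * nat_ext p k.
have c0 k : (k <= n)%N -> 0 < c k by move=> kn; apply: (stationary_ext_gt0 rates irr stat).
have w0 k : (k < n)%N -> 0 < w k by move=> kn; apply: (conductance_gt0 rates irr stat).
have i0n : (i0 <= n)%N by rewrite -ltnS.
have c1 : \sum_(0 <= k < n.+1) c k = 1.
  by have [_ <- _] := stat; rewrite big_nat_ext.
rewrite mass_state_itv // in i0_left; rewrite mass_state_itv // in i0_right.
have [a [h [a0 eqs h0 hd amin]]] := flux_equations_first c0 w0 n_ge1.
have lamE : lam = a.
  have gap_a : is_spectral_gap (bd_matrix p q r) a.
    split; last 1 first.
    - move=> mu /eigenvalueP[v ev v0] mu0.
      apply: amin (eigenvector_flux rates irr stat mu0 ev) _ _.
        exact: (eigenvalue_gt0 rates irr stat mu0 v0 ev).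
      have /rV0Pn[i vi] := v0.
      exists (nat_of_ord i); first by rewrite -ltnS.
      by rewrite nat_ext_ord mulf_neq0 // invr_eq0 gt_eqF // c0 // -ltnS.
    - apply/eigenvalueP; exists (\row_i (c i * h i)).
        exact: (flux_eigenvector rates stat).
      apply/eqP => /rowP/(_ ord0); rewrite !mxE => /eqP.
      by rewrite gt_eqF // mulr_gt0 // c0.
    - by rewrite gt_eqF.
  (* Two least nonzero eigenvalues coincide, so the choice made in [spectral_gap] is [a]. *)
  apply: (xget_unique _ gap_a) => b [evb b0 bmin].
  have [eva ane0 amin'] := gap_a.
  by apply/le_anti; rewrite bmin // amin'.
have leftE (j : 'I_n.+1) : (j < i0)%N ->
    \sum_(k < n.+1 | (j <= k < i0)%N) mass pi (state_itv n 0 j) / (pi 0 k * p k) =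
    (\sum_(0 <= k < j.+1) c k) * \sum_(j <= k < i0) (w k)^-1.
  move=> ji; rewrite -mulr_sumr mass_state_itv; last by rewrite -ltnS.
  congr (_ * _); rewrite (big_nat_widenl j 0) // (big_nat_widen _ _ n.+1) ?big_mkord; last lia.
  by apply: eq_big => [k|k _]; [rewrite andbC | rewrite /w /c !nat_ext_ord].
have rightE (j : 'I_n.+1) : (i0 < j)%N ->
    \sum_(k < n.+1 | (i0 < k <= j)%N) mass pi (state_itv n j n) / (pi 0 k * q k) =
    (\sum_(j <= k < n.+1) c k) * \sum_(i0 <= k < j) (w k)^-1.
  move=> ij; have jn : (j <= n)%N by rewrite -ltnS.
  rewrite -mulr_sumr mass_state_itv //; congr (_ * _).
  (* Detailed balance turns [pi k * q k] into the conductance of edge [k - 1], hence the shift by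
     one. *)
  have -> : \sum_(i0 <= k < j) (w k)^-1 =
      \sum_(i0.+1 <= k < j.+1) (c k * nat_ext q k)^-1.
    rewrite big_add1 /=; apply: eq_big_nat => k ki; congr _^-1.
    by rewrite [LHS](detailed_balance rates stat) //; lia.
  rewrite (big_nat_widenl i0.+1 0) // (big_nat_widen _ _ n.+1) ?big_mkord //.
  by apply: eq_big => [k|k _]; [rewrite ltnS andbC | rewrite /c !nat_ext_ord].
have lower : 1 <= 4 * ell * a.
  have norm_gt0 : 0 < \sum_(0 <= k < n.+1) c k * h k ^+ 2.
    rewrite big_ltn // ltr_pwDl ?mulr_gt0 ?exprn_gt0 ?c0 //.
    by apply: sum_nat_ge0 => k kn; rewrite mulr_ge0 ?sqr_ge0 // ltW // c0 //; lia.
  rewrite -(ler_pM2r norm_gt0) mul1r -[leRHS]mulrA.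
  apply: (flux_lower i0n c0 w0 c1 eqs) => [j ji|j /andP[ij jn]].
    have jn : (j < n.+1)%N by lia.
    rewrite -(leftE (Ordinal jn) ji) /ell /bd_ell le_max; apply/orP; left.
    by apply: (le_bigmax_cond _ (j := Ordinal jn)).
  have jn' : (j < n.+1)%N by lia.
  rewrite -(rightE (Ordinal jn') ij) /ell /bd_ell le_max; apply/orP; right.
  by apply: (le_bigmax_cond _ (j := Ordinal jn')).
(* Positivity is read off [1 <= 4 * ell * a] with [a > 0]. *)
have ell_gt0 : 0 < ell.
  by rewrite -(pmulr_lgt0 _ a0) -(pmulr_rgt0 _ (_ : 0 < 4 :> R)) // mulrA (lt_le_trans _ lower).
rewrite lamE; split.
  by rewrite ler_pdivrMr ?mulr_gt0 // mulrC.
(* In the form [ell <= 2 / a] the bound can be checked on each term of the maxima; [a2] covers their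
   initial value 0. *)
rewrite ler_pdivlMr // mulrC -ler_pdivlMr //.
have le2a x : a * x <= 2 -> x <= 2 / a by rewrite ler_pdivlMr // mulrC.
have a2 : 0 <= 2 / a by rewrite divr_ge0 // ltW.
rewrite /ell /bd_ell ge_max; apply/andP; split; apply: bigmax_le => // j ji.
- by rewrite leftE //; apply/le2a/(flux_upper_left i0n ji (ltW a0) c0 w0 c1 _ hd eqs).
- rewrite rightE //; apply/le2a/(flux_upper_right _ (ltW a0) c0 w0 c1 _ hd eqs) => //.
  by rewrite ji -ltnS /=.
Qed.
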